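(* Let $h\geq 1$, let $P$ be a poset of height at most $h$, let $G$ denote its cover graph, and let $c:=\operatorname{wcol}_{3h-3}(G)$. Then $\dim(P)\leq 4^{c}$.
   Context: Graphs and posets are finite and nonempty. The height of a poset is the maximum size of a chain in it. An element $y$ covers an element $x$ in $P$ if $x<y$ in $P$ and there is no $z$ with $x<z<y$ in $P$. The cover graph of $P$ is the undirected graph on the elements of $P$ whose edges are the pairs $\{x,y\}$ such that one of $x,y$ covers the other. The dimension $\dim(P)$ is the least $d$ such that the set $\operatorname{Inc}(P)$ of ordered pairs $(x,y)$ of incomparable elements of $P$ can be partitioned into $d$ reversible sets, where $I\subseteq \operatorname{Inc}(P)$ is reversible if some linear extension $L$ of $P$ satisfies $x>y$ in $L$ for all $(x,y)\in I$; if $\operatorname{Inc}(P)=\emptyset$ then $\dim(P)=1$. Weak coloring numbers: let $G$ be a graph, $\pi$ a linear order on $V(G)$, and $r\geq 0$ an integer. A vertex $u$ is weakly $r$-reachable from $v$ w.r.t. $\pi$ if there is a path of length at most $r$ (number of edges) from $v$ to $u$ in $G$ whose smallest vertex w.r.t. $\pi$ is $u$. Let $\operatorname{WReach}_r^{\pi}[v]$ be the set of vertices weakly $r$-reachable from $v$ (it contains $v$). The weak $r$-coloring number is $\operatorname{wcol}_r(G):=\min_{\pi}\max_{v\in V(G)}|\operatorname{WReach}_r^{\pi}[v]|$, the minimum being over all linear orders $\pi$ on $V(G)$. *)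

(* Defs.v *)
From HB Require Import structures.
From mathcomp Require Import all_boot all_order.

Set Implicit Arguments.
Unset Strict Implicit.
Unset Printing Implicit Defensive.

Import Order.TTheory.

(* A binary relation L on a finite type is represented by the set of pairs
   (x, y) with "x L y", so that one can quantify over relations in bool. *)

Section Relations.
Variable T : finType.
Implicit Types (L R : {set T * T}) (x y : T).

Definition partial_order L : bool :=
  [&& [forall x, (x, x) \in L],
      [forall x, forall y, ((x, y) \in L) && ((y, x) \in L) ==> (x == y)] &
      [forall x, forall y, forall z,
         ((x, y) \in L) && ((y, z) \in L) ==> ((x, z) \in L)]].

Definition linear_order L : bool :=
  partial_order L && [forall x, forall y, ((x, y) \in L) || ((y, x) \in L)].

Lemma partial_orderP L :
  reflect [/\ forall x, (x, x) \in L,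
              forall x y, (x, y) \in L -> (y, x) \in L -> x = y &
              forall x y z, (x, y) \in L -> (y, z) \in L -> (x, z) \in L]
          (partial_order L).
Proof.
apply: (iffP and3P) => -[r a t]; split.
- exact/forallP.
- move=> x y xy yx; apply/eqP.
  by move: a => /forallP/(_ x)/forallP/(_ y); rewrite xy yx.
- move=> x y z xy yz.
  by move: t => /forallP/(_ x)/forallP/(_ y)/forallP/(_ z); rewrite xy yz.
- exact/forallP.
- apply/forallP=> x; apply/forallP=> y; apply/implyP=> /andP[xy yx].
  by apply/eqP; apply: a.
- apply/forallP=> x; apply/forallP=> y; apply/forallP=> z.
  by apply/implyP=> /andP[]; apply: t.
Qed.

Lemma partial_order_add R x y : partial_order R -> (x, y) \notin R ->
  exists R', [/\ partial_order R', R \subset R' & (y, x) \in R'].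
Proof.
move=> /partial_orderP[r a t] nxy.
exists (R :|: [set p | ((p.1, y) \in R) && ((x, p.2) \in R)]); split.
- apply/partial_orderP; split.
  + by move=> z; rewrite !inE r.
  + move=> u v; rewrite !inE /=.
    case/orP=> [uv|/andP[uy xv]]; case/orP=> [vu|/andP[vy xu]].
    * exact: a.
    * by case/negP: nxy; apply: t xu (t _ _ _ uv vy).
    * by case/negP: nxy; apply: t xv (t _ _ _ vu uy).
    * by case/negP: nxy; apply: t xv vy.
  + move=> u v w; rewrite !inE /=.
    case/orP=> [uv|/andP[uy xv]]; case/orP=> [vw|/andP[vy xw]].
    * by rewrite (t _ _ _ uv vw).
    * by rewrite (t _ _ _ uv vy) xw orbT.
    * by rewrite uy (t _ _ _ xv vw) orbT.
    * by rewrite uy xw orbT.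
- exact: subsetUl.
- by rewrite !inE /= !r orbT.
Qed.

(* Szpilrajn's theorem, for a finite partial order. *)
Lemma linear_order_extends R : partial_order R ->
  exists2 L, linear_order L & R \subset L.
Proof.
move=> poR; have [L maxL sRL] := maxset_exists poR.
exists L => //; have poL := maxsetp maxL.
apply/andP; split=> //; apply/forallP=> x; apply/forallP=> y.
have [//|nxy] := boolP ((x, y) \in L).
have [L' [poL' sLL' yx]] := partial_order_add poL nxy.
by rewrite -(maxsetsup maxL poL' sLL') yx.
Qed.

Lemma linear_order_exists : exists L, linear_order L.
Proof.
have po : partial_order [set p : T * T | p.1 == p.2].
  apply/partial_orderP; split=> [x|x y|x y z]; rewrite !inE //=.
    by move=> /eqP.
  by move=> /eqP-> /eqP->.
by have [L lL _] := linear_order_extends po; exists L.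
Qed.

End Relations.

Record sgraph (T : finType) := SGraph {
  adj :> rel T;
  adj_sym : symmetric adj;
  adj_irrefl : irreflexive adj }.

Section WeakColoring.
Variables (T : finType) (G : sgraph T).
Implicit Types (pi : {set T * T}) (r : nat) (u v : T).

(* The path is v :: p, which has size p edges. *)
Definition wreachable pi r v u : bool :=
  [exists k : 'I_r.+1, exists p : k.-tuple T,
     [&& path G v p, uniq (v :: p), last v p == u &
         all (fun w => (u, w) \in pi) (v :: p)]].

Definition WReach pi r v : {set T} := [set u | wreachable pi r v u].

Definition wcol_attained r (c : nat) : bool :=
  [exists pi : {set T * T},
     linear_order pi && (\max_(v : T) #|WReach pi r v| == c)].

Lemma wcol_attained_ex r : exists c, wcol_attained r c.
Proof.
have [pi lin_pi] := linear_order_exists T.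
exists (\max_(v : T) #|WReach pi r v|).
by apply/existsP; exists pi; rewrite lin_pi eqxx.
Qed.

Definition wcol r : nat := ex_minn (wcol_attained_ex r).

End WeakColoring.

Section Posets.
Local Open Scope order_scope.
Variables (disp : Order.disp_t) (P : finPOrderType disp).
Implicit Types (x y z : P) (L : {set P * P}).

Definition chain (C : {set P}) : bool :=
  [forall x in C, forall y in C, x >=< y].

Definition height : nat := (\max_(C : {set P} | chain C) #|C|)%N.

Definition covers y x : bool := (x < y) && ~~ [exists z, x < z < y].

Definition cover_adj : rel P := fun x y => covers x y || covers y x.

Lemma cover_adj_sym : symmetric cover_adj.
Proof. by move=> x y; rewrite /cover_adj orbC. Qed.

Lemma cover_adj_irrefl : irreflexive cover_adj.
Proof. by move=> x; rewrite /cover_adj /covers ltxx. Qed.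

Definition cover_graph : sgraph P := SGraph cover_adj_sym cover_adj_irrefl.

Definition Inc : {set P * P} := [set p | p.1 >< p.2].

Definition linear_extension L : bool :=
  linear_order L && [forall x, forall y, (x <= y) ==> ((x, y) \in L)].

Definition reversible (I : {set P * P}) : bool :=
  (I \subset Inc) &&
  [exists L, linear_extension L &&
     [forall p in I, (p.2 != p.1) && ((p.2, p.1) \in L)]].

(* The parts of a [partition] are nonempty, so d = 0 is possible only when Inc
   is empty; [dim] treats that case separately. *)
Definition Inc_partition (d : nat) : bool :=
  [exists Q : {set {set P * P}},
     [&& partition Q Inc, [forall I in Q, reversible I] & #|Q| == d]].

Lemma reversible1 p : p \in Inc -> reversible [set p].
Proof.
case: p => x y pI; rewrite /reversible sub1set pI /=.
move: pI; rewrite inE /= => nxy.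
have po : partial_order [set p : P * P | p.1 <= p.2].
  apply/partial_orderP; split=> [u|u v|u v w]; rewrite !inE //=.
    by move=> uv vu; apply/le_anti/andP.
  exact: le_trans.
have nle : (x, y) \notin [set p : P * P | p.1 <= p.2].
  by rewrite inE /=; apply: contra nxy => xy; apply: le_comparable.
have [R [poR sR yx]] := partial_order_add po nle.
have [L lL sL] := linear_order_extends poR.
apply/existsP; exists L; apply/andP; split.
  rewrite /linear_extension lL /=; apply/forallP=> u; apply/forallP=> v.
  by apply/implyP=> uv; apply/(subsetP sL)/(subsetP sR); rewrite inE.
apply/forallP=> q; apply/implyP; rewrite inE => /eqP-> /=.
rewrite (subsetP sL _ yx) andbT.
by apply: contra nxy => /eqP->; apply: comparablexx.
Qed.

Lemma Inc_partition_ex : exists d, Inc_partition d.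
Proof.
pose Q := [set [set p] | p in Inc].
exists #|Q|; apply/existsP; exists Q; rewrite eqxx andbT; apply/andP; split.
  apply/and3P; split.
  - rewrite /cover; apply/eqP/setP=> p; apply/bigcupP/idP.
      by case=> A /imsetP[q qI ->]; rewrite inE => /eqP->.
    by move=> pI; exists [set p]; [apply: imset_f | rewrite inE].
  - apply/trivIsetP=> A B /imsetP[p _ ->] /imsetP[q _ ->] neq.
    rewrite disjoints1 inE.
    by apply: contra neq => /eqP->.
  - by apply/imsetP=> -[p _ /setP/(_ p)]; rewrite !inE eqxx.
by apply/forall_inP=> A /imsetP[p pI ->]; apply: reversible1.
Qed.

Definition dim : nat :=
  if Inc == set0 then 1%N else ex_minn Inc_partition_ex.

End Posets.

(* Main.v *)
Require Import Defs.
From HB Require Import structures.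
From mathcomp Require Import all_boot all_order.
From mathcomp Require Import zify.

Set Implicit Arguments.
Unset Strict Implicit.
Unset Printing Implicit Defensive.

Import Order.TTheory.

(** A set I of incomparable pairs that is not reversible contains an
    alternating cycle: pairs p_1, ..., p_k in I, with p_j = (x_j, y_j) and
    x_j <= y_{j+1} cyclically (lemma [not_reversible]).  So the task is to
    split the incomparable pairs into 4 ^ c classes without such cycles.

    Fix an order pi attaining c = wcol_{3n}, where n = h - 1, and write rk for
    the position in pi.  Colour the elements greedily with c colours so that
    no element shares its colour with another one that is weakly
    3n-reachable from it ([greedy_colouring]).  Call a an up-mark of x if
    x <= a and a is weakly n-reachable from x, and dually b a down-mark of y if
    b <= y and b is weakly n-reachable from y.  An element has at most one
    up-mark and one down-mark of each colour, because two of them are the ends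
    of a walk of length 2n whose lowest vertex is one of its ends.  The class
    of an incomparable pair (x, y) records, for each colour i, which of these
    four situations holds:  x has no up-mark of colour i; it has one but y has
    no down-mark of colour i; both marks a and b exist and rk a < rk b; both
    exist and rk a > rk b.  Equality a = b is impossible, since it would give
    x <= a <= y.

    Suppose that a class contains an alternating cycle.  Each comparability
    x_j <= y_{j+1} is realised by a chain of covers, which is a walk with at
    most n edges; its pi-lowest vertex z_j, the hub, is both an up-mark of x_j
    and a down-mark of y_{j+1}.  Take the hub z = z_j of least rank among all
    of them, and let i be its colour.  Then x_j has an up-mark and y_{j+1} a
    down-mark of colour i, so all pairs of the cycle are in the third or all
    are in the fourth situation for i.  In the third one, let a be the up-mark
    of x_{j+1}, so that rk a < rk z; from there, walk to x_{j+1}, along the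
    chain to y_{j+2}, and to the down-mark b of y_{j+2}.  This walk has length
    at most 3n, and its lowest vertex is a or b since the chain stays at rank
    at least rk z.  Hence a = b ([mark_unique]), and the up-mark of x_{j+2} is
    strictly below b = a.  Continuing, the ranks decrease forever around the
    cycle, which is absurd.  The fourth situation is the same argument with
    the cycle traversed backwards ([monochromatic_reversible]). *)

(** * Greedy colouring *)

(** Colours are assigned in increasing order of rank, so that all elements of
    W v other than v are coloured before v; being at most c, they leave one of
    the c + 1 colours free. *)
Lemma greedy_colouring (T : finType) (rk : T -> nat) (W : T -> {set T}) c :
    (forall u v, u \in W v -> u != v -> rk u < rk v) ->
    (forall v, #|W v :\ v| <= c) ->
  exists f : T -> 'I_c.+1, forall u v, u \in W v -> u != v -> f u != f v.
Proof.
move=> rkW cW.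
have [n] : exists n, forall v, rk v < n.
  by exists (\max_v rk v).+1 => v; rewrite ltnS leq_bigmax.
suff: exists f : T -> 'I_c.+1, forall u v,
    rk v < n -> u \in W v -> u != v -> f u != f v.
  by case=> f fP lt_n; exists f => u v; apply: fP.
elim: n => [|n [f fP]]; first by exists (fun=> ord0).
have free v : exists i, i \notin f @: (W v :\ v).
  apply/existsP; rewrite -negb_forall; apply/negP=> /forallP full.
  have : #|'I_c.+1| <= #|f @: (W v :\ v)|.
    by apply: subset_leq_card; apply/subsetP=> i _; apply: full.
  by rewrite card_ord; apply/negP; rewrite -leqNgt (leq_trans (leq_imset_card _ _)).
exists (fun v => if rk v < n then f v else xchoose (free v)) => u v vn uW uv.
have uvrk := rkW _ _ uW uv.
have un : rk u < n by apply: leq_trans uvrk _.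
rewrite un; case: ifP => [vn'|_]; first exact: fP.
apply: contraNneq (xchooseP (free v)) => <-.
by apply: imset_f; rewrite !inE uv.
Qed.

(** * Walks above a rank threshold *)

(** Position in a linear order: comparing elements becomes comparing natural
    numbers. *)
Definition rank (T : finType) (pi : {set T * T}) v := #|[set u | (u, v) \in pi]|.

Lemma rank_leq (T : finType) (pi : {set T * T}) u v :
  linear_order pi -> (rank pi u <= rank pi v) = ((u, v) \in pi).
Proof.
case/andP=> /partial_orderP[r a t] /forallP tot.
have mono x y : (x, y) \in pi -> rank pi x <= rank pi y.
  by move=> xy; apply/subset_leq_card/subsetP=> w; rewrite !inE => /t/(_ xy).
apply/idP/idP=> [uv|]; last exact: mono.
have /orP[//|vu] := forallP (tot u) v.
have /eqP/setP/(_ u) : [set w | (w, v) \in pi] == [set w | (w, u) \in pi].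
  by rewrite eqEcard uv andbT; apply/subsetP=> w; rewrite !inE => /t/(_ vu).
by rewrite !inE r.
Qed.

Lemma rank_inj (T : finType) (pi : {set T * T}) :
  linear_order pi -> injective (rank pi).
Proof.
move=> lin u v uv; have /andP[/partial_orderP[_ a _] _] := lin.
by apply: a; rewrite -rank_leq // uv.
Qed.

Section Walks.
Variables (T : finType) (G : sgraph T) (pi : {set T * T}).
Hypothesis lin_pi : linear_order pi.
Let rk := rank pi.

(** A walk from v to u with at most n edges, all of whose vertices have rank
    at least m.  Dropping the requirement that vertices be distinct makes
    concatenation immediate; [walk_WReach] restores it. *)
Definition walk m n v u := exists p,
  [/\ path G v p, last v p = u, size p <= n & all (fun w => m <= rk w) (v :: p)].

Lemma walk_refl m n v : m <= rk v -> walk m n v v.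
Proof. by move=> mv; exists [::]; rewrite /= mv. Qed.

Lemma walk_sym m n v u : walk m n v u -> walk m n u v.
Proof.
case=> p [pp <- sp mp]; exists (rev (belast v p)); split.
- rewrite rev_path; apply: sub_path pp => x y; by rewrite adj_sym.
- by case: p {pp sp mp} => //= x p; rewrite rev_cons last_rcons.
- by rewrite size_rev size_belast.
- by rewrite -rev_rcons -lastI all_rev.
Qed.

Lemma walk_trans m n1 n2 v u w :
  walk m n1 v u -> walk m n2 u w -> walk m (n1 + n2) v w.
Proof.
case=> p [pp <- sp mp] [q [pq <- sq mq]]; exists (p ++ q); split.
- by rewrite cat_path pp.
- by rewrite last_cat.
- by rewrite size_cat leq_add.
- by rewrite -cat_cons all_cat mp; case/andP: mq.
Qed.

Lemma walk_mono m m' n n' v u :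
  m' <= m -> n <= n' -> walk m n v u -> walk m' n' v u.
Proof.
move=> mm nn [p [pp lp sp mp]]; exists p; split=> //; first exact: leq_trans nn.
by apply: sub_all mp => w; apply: leq_trans.
Qed.

Lemma walk_geq m n v u : walk m n v u -> m <= rk v.
Proof. by case=> p [_ _ _ /andP[]]. Qed.

Lemma walk_WReach n v u : u \in WReach G pi n v <-> walk (rk u) n v u.
Proof.
rewrite inE; split.
  case/existsP=> k /existsP[p /and4P[pp _ /eqP lp ap]].
  exists p; split=> //; first by rewrite size_tuple -ltnS.
  by apply: sub_all ap => w; rewrite /rk rank_leq.
case=> p [pp lp sp ap].
case/shortenP: pp lp => q pq uq sub lq.
have sq : size q < n.+1.
  by rewrite ltnS (leq_trans _ sp) // uniq_leq_size //; case/andP: uq.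
apply/existsP; exists (Ordinal sq); apply/existsP; exists (in_tuple q).
rewrite pq uq lq eqxx /=.
move: ap => /= /andP[av /allP ap]; rewrite -rank_leq // av /=.
by apply/allP=> w /sub wp; rewrite -rank_leq // ap.
Qed.

(** The lowest vertex of the concatenated walk from a to b is one of its ends,
    so that the lower end is weakly 3n-reachable from the other one. *)
Lemma mark_unique (C : eqType) (f : T -> C) n k x y a b :
    (forall u v, u \in WReach G pi (3 * n) v -> u != v -> f u != f v) ->
    walk (rk a) n x a -> walk k n x y -> walk (rk b) n y b ->
    minn (rk a) (rk b) <= k -> f a = f b -> a = b.
Proof.
move=> fP xa xy yb mk fab.
have ab : walk (minn (rk a) (rk b)) (3 * n) a b.
  have -> : 3 * n = n + n + n by lia.
  apply: walk_trans (walk_trans _ _) _; last first.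
  - exact: walk_mono (geq_minr _ _) (leqnn _) yb.
  - exact: walk_mono mk (leqnn _) xy.
  - exact/walk_sym/(walk_mono (geq_minl _ _) (leqnn _) xa).
apply/eqP; apply: contraT => nab.
have [le|lt] := leqP (rk a) (rk b).
  move: ab; rewrite (minn_idPl le) => /walk_sym/walk_WReach/fP/(_ nab).
  by rewrite fab eqxx.
move: ab; rewrite (minn_idPr (ltnW lt)) => /walk_WReach/fP.
by rewrite eq_sym fab eqxx => /(_ nab).
Qed.

End Walks.

(** * Chains, hubs and alternating cycles *)

Section Posets.
Local Open Scope order_scope.
Variables (disp : Order.disp_t) (P : finPOrderType disp).
Implicit Types (x y z : P) (p q : P * P) (I : {set P * P}).

Lemma cover_chain x y : x <= y ->
  exists2 s, path (fun a b => covers b a) x s & last x s = y.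
Proof.
have [n] := ubnP #|[set w | x <= w <= y]|.
elim: n x y => // n IHn x y ltn; rewrite le_eqVlt => /orP[/eqP->|xy].
  by exists [::].
have [cov|] := boolP (covers y x); first by exists [:: y]; rewrite /= ?cov.
rewrite /covers xy negbK => /existsP[z /andP[xz zy]].
have small a b c : x <= a -> b <= y -> x <= c <= y -> ~~ (a <= c <= b) ->
    (#|[set w | (a <= w <= b)%O]| < n)%N.
  move=> xa yb cxy cab; rewrite ltnS in ltn; apply: leq_trans ltn.
  apply: proper_card; apply/properP; split.
    apply/subsetP=> w; rewrite !inE => /andP[aw wb].
    by rewrite (le_trans xa aw) (le_trans wb yb).
  by exists c; rewrite inE.
have [|s1 p1 l1] := IHn x z _ (ltW xz).
  apply: (small _ _ y) => //; rewrite ?(ltW xy) ?(ltW zy) ?lexx //=.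
  by rewrite (lt_geF zy).
have [|s2 p2 l2] := IHn z y _ (ltW zy).
  apply: (small _ _ x) => //; rewrite ?(ltW xy) ?(ltW xz) ?lexx //=.
  by rewrite (lt_geF xz).
by exists (s1 ++ s2); rewrite ?cat_path ?last_cat l1 ?p1.
Qed.

Lemma lt_path_height x s : path <%O x s -> (size s < height P)%N.
Proof.
move=> ps; have us : uniq (x :: s) by apply: (@sorted_uniq _ <%O lt_trans ltxx).
have -> : (size s).+1 = #|[set w in x :: s]| by rewrite cardsE (card_uniqP us).
apply: leq_bigmax_cond.
suff cmp : {in x :: s &, forall u w, u >=< w}.
  by apply/forall_inP=> u; rewrite in_set => us'; apply/forall_inP=> w;
    rewrite in_set; apply: cmp.
elim: s x ps {us} => [|b s IHs] x ps u w.
  by rewrite !inE => /eqP-> /eqP->; rewrite comparablexx.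
have /allP mins := order_path_min lt_trans ps.
rewrite !(in_cons x) => /orP[/eqP->|ub] /orP[/eqP->|wb].
- by rewrite comparablexx.
- by rewrite lt_comparable // mins.
- by rewrite comparable_sym lt_comparable // mins.
- by apply: (IHs b) => //; case/andP: ps.
Qed.

Definition up_mark (pi : {set P * P}) n x a :=
  (x <= a) && (a \in WReach (cover_graph P) pi n x).

Definition down_mark (pi : {set P * P}) n y b :=
  (b <= y) && (b \in WReach (cover_graph P) pi n y).

(** The hub of x <= y is the lowest vertex of a chain of covers from x to y.
    The last clause bounds the direct walk from x to y through z by n, whereas
    concatenating the walks from x to z and from z to y would only give 2n. *)
Definition hub (pi : {set P * P}) n x y z :=
  [/\ up_mark pi n x z, down_mark pi n y z &
      walk (cover_graph P) pi (rank pi z) n x y].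

Lemma hub_exists (pi : {set P * P}) n x y :
  linear_order pi -> (height P <= n.+1)%N -> x <= y -> exists z, hub pi n x y z.
Proof.
move=> lin hP xy; have [s ps ls] := cover_chain xy.
have pG : path (cover_graph P) x s.
  by apply: sub_path ps => a b ab; rewrite /= /cover_adj ab orbT.
have plt : path <%O x s by apply: sub_path ps => a b /andP[].
have ss : (size s <= n)%N.
  by rewrite -ltnS; apply: leq_trans (lt_path_height plt) hP.
case: (@arg_minnP _ x (mem (x :: s)) (rank pi)) => [|z zs minz].
  exact: mem_head.
have minA : all (fun w => rank pi z <= rank pi w)%N (x :: s) by apply/allP.
exists z; move: ls ss pG plt minA {ps minz}.
case/splitPl: {s} zs => s1 s2 lz.
rewrite last_cat lz size_cat !cat_path lz => ly ss /andP[pG1 pG2] /andP[lt1 lt2].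
rewrite -cat_cons all_cat => /andP[m1 m2].
have m2' : all (fun w => rank pi z <= rank pi w)%N (z :: s2) by rewrite /= leqnn.
have xz : walk (cover_graph P) pi (rank pi z) (size s1) x z by exists s1.
have zy : walk (cover_graph P) pi (rank pi z) (size s2) z y by exists s2.
split.
- apply/andP; split; last first.
    by apply/(walk_WReach _ lin); apply: walk_mono xz => //; apply: leq_trans ss; apply: leq_addr.
  rewrite -lz; have /allP := order_path_min lt_trans lt1.
  by case/lastP: (s1) => [|s a] //= mins; rewrite last_rcons ltW // mins // mem_rcons inE eqxx.
- apply/andP; split; last first.
    by apply/(walk_WReach _ lin)/walk_sym; apply: walk_mono zy => //; apply: leq_trans ss; apply: leq_addl.
  rewrite -ly; have /allP := order_path_min lt_trans lt2.
  by case/lastP: (s2) => [|s a] //= mins; rewrite last_rcons ltW // mins // mem_rcons inE eqxx.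
- by apply: walk_mono (walk_trans xz zy).
Qed.

(** Without alternating cycles, adding y <= x for every pair (x, y) of I to
    the order of P and closing transitively creates no cycle, so the result
    extends to a linear order. *)
Lemma not_reversible I : I \subset Inc P -> ~~ reversible I ->
  exists s : seq (P * P),
    [/\ s != [::], {subset s <= I} & cycle (fun p q => p.1 <= q.2) s].
Proof.
move=> sI nrev; pose D p q := [&& p \in I, q \in I & p.1 <= q.2].
have [/existsP[p /existsP[q /andP[/connectP[s ps lq] qp]]]|acyc] :=
    boolP [exists p, exists q, connect D p q && D q p].
  have cyc : cycle D (p :: s) by rewrite /= rcons_path ps -lq.
  exists (p :: s); split=> //; last by apply: sub_cycle cyc => a b /and3P[].
  by move=> a /(next_cycle cyc) /andP[].
have noD p q : connect D p q -> D q p -> False.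
  move=> pq qp; case/negP: acyc; apply/existsP; exists p; apply/existsP.
  by exists q; rewrite pq.
pose R := [set ab : P * P | (ab.1 <= ab.2) || [exists p in I, exists q in I,
             [&& ab.1 <= p.2, connect D p q & q.1 <= ab.2]]].
have RP a b : reflect (a <= b \/ exists p q, [/\ p \in I, q \in I, a <= p.2,
      connect D p q & q.1 <= b]) ((a, b) \in R).
  rewrite inE /=; apply: (iffP orP) => -[ab|]; try by left.
    case/exists_inP=> p pI /exists_inP[q qI /and3P[? ? ?]].
    by right; exists p, q.
  case=> p [q [pI qI ap pq qb]]; right.
  by apply/exists_inP; exists p => //; apply/exists_inP; exists q; rewrite ?ap ?pq.
have poR : partial_order R.
  apply/partial_orderP; split.
  - by move=> a; apply/RP; left.
  - move=> a b /RP[ab|[p [q [pI qI ap pq qb]]]] /RP[ba|[p' [q' [pI' qI' bp pq' qa]]]].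
    + by apply/le_anti/andP.
    + case: (noD _ _ pq'); rewrite /D qI' pI'.
      exact: le_trans qa (le_trans ab bp).
    + case: (noD _ _ pq); rewrite /D qI pI.
      exact: le_trans qb (le_trans ba ap).
    + case: (@noD p q'); last by rewrite /D qI' pI (le_trans qa).
      apply: connect_trans pq (connect_trans _ pq'); apply: connect1.
      by rewrite /D qI pI' (le_trans qb).
  - move=> a b c /RP[ab|[p [q [pI qI ap pq qb]]]] /RP[bc|[p' [q' [pI' qI' bp pq' qc]]]];
      apply/RP.
    + by left; apply: le_trans ab bc.
    + by right; exists p', q'; split=> //; apply: le_trans ab bp.
    + by right; exists p, q; split=> //; apply: le_trans qb bc.
    + right; exists p, q'; split=> //.
      apply: connect_trans pq (connect_trans _ pq'); apply: connect1.
      by rewrite /D qI pI' (le_trans qb).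
have [L linL sRL] := linear_order_extends poR.
case/negP: nrev; rewrite /reversible sI; apply/existsP; exists L.
apply/andP; split.
  rewrite /linear_extension linL; apply/forallP=> a; apply/forallP=> b.
  by apply/implyP=> ab; apply/(subsetP sRL)/RP; left.
apply/forall_inP=> -[a b] abI /=; apply/andP; split.
  have := subsetP sI _ abI; rewrite inE /=.
  by apply: contraNneq => ->; apply: comparablexx.
by apply/(subsetP sRL)/RP; right; exists (a, b), (a, b).
Qed.


(** * Reversibility of the classes *)

Section Classes.
Variables (pi : {set P * P}) (n : nat) (C : finType) (f : P -> C).
Hypothesis lin_pi : linear_order pi.
Hypothesis height_P : (height P <= n.+1)%N.
Hypothesis proper_f : forall u v,
  u \in WReach (cover_graph P) pi (3 * n) v -> u != v -> f u != f v.
Let rk := rank pi.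
Let up := up_mark pi n.
Let down := down_mark pi n.

(** The second component means something else in each case: with both marks
    present it compares them, and otherwise it says whether the up-mark exists.
    The two missing cases must differ, so that a pair with an up-mark and a
    pair with a down-mark in the same situation both have two marks. *)
Definition situation p i : bool * bool :=
  if [pick a | up p.1 a && (f a == i)] is Some a then
    if [pick b | down p.2 b && (f b == i)] is Some b then (true, rk a < rk b)%N
    else (false, true)
  else (false, false).

Lemma linked_marks_eq x y z a b :
    up x a -> down y b -> hub pi n x y z -> (minn (rk a) (rk b) <= rk z)%N ->
  f a = f b -> a = b.
Proof.
case/andP=> _ /(walk_WReach _ lin_pi) xa /andP[_ /(walk_WReach _ lin_pi) yb].
by case=> _ _ xy; apply: mark_unique xy yb.
Qed.

(** The case x = y of the walk argument, with a trivial middle part. *)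
Lemma up_mark_unique x a b : up x a -> up x b -> f a = f b -> a = b.
Proof.
case/andP=> _ /(walk_WReach _ lin_pi) xa /andP[_ /(walk_WReach _ lin_pi) xb].
apply: (mark_unique lin_pi proper_f xa (walk_refl _ _ (leqnn _)) xb).
exact: leq_trans (geq_minl _ _) (walk_geq xa).
Qed.

Lemma down_mark_unique y a b : down y a -> down y b -> f a = f b -> a = b.
Proof.
case/andP=> _ /(walk_WReach _ lin_pi) ya /andP[_ /(walk_WReach _ lin_pi) yb].
apply: (mark_unique lin_pi proper_f ya (walk_refl _ _ (leqnn _)) yb).
exact: leq_trans (geq_minl _ _) (walk_geq ya).
Qed.

Lemma situationE p a b : up p.1 a -> down p.2 b -> f a = f b ->
  situation p (f b) = (true, rk a < rk b)%N.
Proof.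
move=> ua db fab; rewrite /situation.
case: pickP => [a' /andP[ua' /eqP fa']|/(_ a)]; last by rewrite ua fab eqxx.
case: pickP => [b' /andP[db' /eqP fb']|/(_ b)]; last by rewrite db eqxx.
have -> : a' = a by apply: up_mark_unique ua' ua _; rewrite fa' fab.
by have -> : b' = b by apply: down_mark_unique db' db _.
Qed.

Lemma situation_marks p i : (situation p i).1 ->
  exists a b, [/\ up p.1 a, down p.2 b, f a = i & f b = i].
Proof.
rewrite /situation; case: pickP => //= a /andP[ua /eqP fa].
by case: pickP => //= b /andP[db /eqP fb] _; exists a, b.
Qed.

Lemma situation_some p q z : up p.1 z -> down q.2 z ->
  situation p (f z) = situation q (f z) -> (situation p (f z)).1.
Proof.
move=> uz dz; rewrite /situation.
case: pickP => [a _|/(_ z)]; last by rewrite uz eqxx.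
case: pickP => // _; case: pickP => // a' _.
by case: pickP => // /(_ z); rewrite dz eqxx.
Qed.

(** All pairs of an alternating cycle inherit marks of the colour of a lowest
    hub, always in the same relative position; following the cycle in the
    direction that this position dictates, the ranks of the marks decrease
    forever. *)
Lemma monochromatic_reversible I : I \subset Inc P ->
  {in I &, forall p q, situation p =1 situation q} -> reversible I.
Proof.
move=> sI sit; apply: contraT => /(not_reversible sI)[s [s0 ss cyc]].
have sits p q i : p \in s -> q \in s -> situation p i = situation q i.
  by move=> /ss pI /ss qI; apply: sit.
suff nohub m p q z : p \in s -> q \in s -> hub pi n p.1 q.2 z -> rk z = m -> False.
  case: s => // p s in s0 ss cyc sits nohub *.
  have ps := mem_head p s.
  have [z pz] := hub_exists lin_pi height_P (next_cycle cyc ps).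
  by case: (nohub (rk z) p (next (p :: s) p) z); rewrite ?mem_next.
(* Strong induction on the rank of the hub z lets z be lowest among the hubs of
   the cycle: a lower one is excluded by the induction hypothesis. *)
elim/ltn_ind: m p q z => m IHm p q z ps qs hz mz.
have low p' q' z' : p' \in s -> q' \in s -> hub pi n p'.1 q'.2 z' ->
    (rk z <= rk z')%N.
  move=> ps' qs' hz'; rewrite leqNgt; apply/negP; rewrite mz => lt.
  exact: (IHm _ lt _ _ _ ps' qs' hz' erefl).
have [uz dz _] := hz.
have marks t : t \in s ->
    exists a b, [/\ up t.1 a, down t.2 b, f a = f z & f b = f z].
  move=> ts; apply: situation_marks; rewrite (sits t p) //.
  exact: situation_some uz dz (sits _ _ _ ps qs).
have same t t' a b a' b' : t \in s -> t' \in s ->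
    up t.1 a -> down t.2 b -> f a = f z -> f b = f z ->
    up t'.1 a' -> down t'.2 b' -> f a' = f z -> f b' = f z ->
    (rk a < rk b)%N = (rk a' < rk b')%N.
  move=> ts ts' ua db fa fb ua' db' fa' fb'.
  have := sits t t' (f z) ts ts'.
  rewrite -{1}fb (situationE ua db) ?fa // -fb' (situationE ua' db') ?fa' //.
  by case.
have descent (Q : P * P -> P -> Prop) :
    (forall t a, Q t a -> (rk a < rk z)%N ->
       exists t' a', Q t' a' /\ (rk a' < rk a)%N) ->
    forall t a, Q t a -> (rk a < rk z)%N -> False.
  move=> step t a; move: {2}(rk a) (erefl (rk a)) => k.
  elim/ltn_ind: k t a => k IHk t a ka Qa az.
  have [t' [a' [Qa' lt]]] := step _ _ Qa az.
  by apply: (IHk (rk a') _ t' a' erefl Qa'); [rewrite -ka | apply: ltn_trans az].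
have [a0 [b0 [ua0 db0 fa0 fb0]]] := marks p ps.
case lt0: (rk a0 < rk b0)%N.
(* Up-marks descend along the cycle, from the pair q that z reaches. *)
- have up_lower t a b : t \in s -> up t.1 a -> down t.2 b ->
      f a = f z -> f b = f z -> (rk a < rk b)%N.
    by move=> ts ua db fa fb; rewrite -(same p t a0 b0).
  have [a [b [ua db fa fb]]] := marks q qs.
  apply: (descent (fun t a => [/\ t \in s, up t.1 a & f a = f z]) _ q a) => //.
  + move=> t a1 [ts ua1 fa1] lt1; pose t' := next s t.
    have ts' : t' \in s by rewrite mem_next.
    have [a2 [b2 [ua2 db2 fa2 fb2]]] := marks t' ts'.
    have [z' hz'] := hub_exists lin_pi height_P (next_cycle cyc ts).
    have a1b2 : a1 = b2.
      apply: (linked_marks_eq ua1 db2 hz'); last by rewrite fa1.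
      apply: leq_trans (geq_minl _ _) (leq_trans (ltnW lt1) _).
      exact: low ts ts' hz'.
    by exists t', a2; split=> //; rewrite a1b2; apply: (up_lower t').
  + by rewrite (down_mark_unique dz db) ?fb //; apply: (up_lower q).
(* Down-marks descend against the cycle, from the pair p that z comes from. *)
- have down_lower t a b : t \in s -> up t.1 a -> down t.2 b ->
      f a = f z -> f b = f z -> (rk b < rk a)%N.
    move=> ts ua db fa fb.
    have := same p t a0 b0 a b ps ts ua0 db0 fa0 fb0 ua db fa fb.
    rewrite lt0 [RHS]ltnNge => /esym/negbFE.
    rewrite leq_eqVlt => /orP[/eqP/(rank_inj lin_pi) eab|//].
    (* A common mark would make the pair comparable *)
    have := subsetP sI _ (ss _ ts); rewrite inE; case/negP.
    apply: le_comparable; case/andP: ua => ta _; case/andP: db => bt _.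
    by apply: le_trans ta _; rewrite -eab.
  have [a [b [ua db fa fb]]] := marks p ps.
  apply: (descent (fun t b => [/\ t \in s, down t.2 b & f b = f z]) _ p b) => //.
  + move=> t b1 [ts db1 fb1] lt1; pose t' := prev s t.
    have ts' : t' \in s by rewrite mem_prev.
    have [a2 [b2 [ua2 db2 fa2 fb2]]] := marks t' ts'.
    have [z' hz'] := hub_exists lin_pi height_P (prev_cycle cyc ts).
    have a2b1 : a2 = b1.
      apply: (linked_marks_eq ua2 db1 hz'); last by rewrite fa2.
      apply: leq_trans (geq_minr _ _) (leq_trans (ltnW lt1) _).
      exact: low ts' ts hz'.
    by exists t', b2; split=> //; rewrite -a2b1; apply: (down_lower t').
  + by rewrite (up_mark_unique uz ua) ?fa //; apply: (down_lower p).
Qed.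

End Classes.

Lemma dim_le (C : finType) (g : P * P -> C) : (0 < #|C|)%N ->
    (forall I, I \subset Inc P -> {in I &, forall p q, g p = g q} ->
       reversible I) ->
  (dim P <= #|C|)%N.
Proof.
move=> C0 rev_g; rewrite /dim; case: ifP => // _.
case: ex_minnP => d _ mind; pose Q := preim_partition g (Inc P).
have : (#|Q| <= #|C|)%N.
  pose block i := [set q in Inc P | i == g q].
  apply: leq_trans (max_card (mem (g @: Inc P))).
  rewrite (_ : Q = block @: (g @: Inc P)) ?leq_imset_card //.
  by rewrite -imset_comp; apply: eq_imset => p.
apply: leq_trans; apply: mind; apply/existsP; exists Q.
rewrite preim_partitionP eqxx andbT; apply/forall_inP=> I /imsetP[r _ ->].
apply: rev_g => [|p q]; first by apply/subsetP=> p; rewrite inE => /andP[].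
by rewrite !inE => /andP[_ /eqP<-] /andP[_ /eqP<-].
Qed.

End Posets.

Theorem theorem2 (disp : Order.disp_t) (P : finPOrderType disp) (h : nat)
    (P_nonempty : 0 < #|P|) (h_ge1 : 1 <= h) (height_P : height P <= h) :
  dim P <= 4 ^ wcol (cover_graph P) (3 * h - 3).
Proof.
case: h h_ge1 height_P => // n _ height_P.
have -> : 3 * n.+1 - 3 = 3 * n by lia.
rewrite /wcol; case: ex_minnP => c /existsP[pi /andP[lin /eqP cE]] _.
have Wself v : v \in WReach (cover_graph P) pi (3 * n) v.
  by apply/(walk_WReach _ lin)/walk_refl.
have Wc v : #|WReach (cover_graph P) pi (3 * n) v :\ v| < c.
  rewrite -cE; apply: leq_trans (leq_bigmax v).
  by rewrite (cardsD1 v (WReach _ _ _ v)) Wself.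
have [v0 _] : exists v : P, v \in P by apply/card_gt0P.
case: c cE Wc => [cE /(_ v0)//|c _ Wc].
have [||f fP] := @greedy_colouring P (rank pi) (WReach (cover_graph P) pi (3 * n)) c.
- move=> u v /(walk_WReach _ lin)/walk_geq uv nuv.
  by rewrite ltn_neqAle uv andbT; apply: contra nuv => /eqP/(rank_inj lin)->.
- by move=> v; rewrite -ltnS.
pose g p := [ffun i => situation pi n f p i].
have card4 : #|{: {ffun 'I_c.+1 -> bool * bool}}| = 4 ^ c.+1.
  by rewrite card_ffun card_prod card_bool card_ord.
rewrite -card4; apply: (dim_le (g := g)) => [|I sI gI].
  by rewrite card4 expn_gt0.
apply: (monochromatic_reversible lin height_P fP sI) => p q pI qI i.
by have /ffunP/(_ i) := gI p q pI qI; rewrite !ffunE.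
Qed.
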